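(* Let $n\ge5$ and $2\le s\le\lfloor\frac{n-1}{2}\rfloor$ be integers. For every vertex $i\in\{0,1,\ldots,n-1\}$ of $C_n(1,s)$, the distance $d(i)$ from $0$ to $i$ in $C_n(1,s)$ is $$d(i)=\min\left(\ell^1(i),\ell^2(i),\ell^{1,t}(i),\ell^{2,t}(i),\ell^{3,t}(i),\ell^{4,t}(i)\right),$$ where the minimum is taken over the six quantities with $t$ ranging over all integers $1\le t\le\frac{s}{\gcd(n,s)}$.
   Context: For integers $n\ge5$ and $2\le s\le\lfloor\frac{n-1}{2}\rfloor$, the circulant graph $C_n(1,s)$ is the graph with vertex set $\{0,1,\ldots,n-1\}$ in which two distinct vertices $i,j$ are adjacent if and only if $|i-j|_n\in\{1,s\}$, where $|x|_n=\min(|x|,n-|x|)$. Distance is the length (number of edges) of a shortest path. For a vertex $i$ and an integer $t$ with $1\le t\le\frac{s}{\gcd(n,s)}$, define by division by $s$ with remainders in $\{0,\ldots,s-1\}$: $q=\lfloor\frac{i}{s}\rfloor$ and $r=i-qs$; $q_t=\lfloor\frac{tn+i}{s}\rfloor$ and $r_t=tn+i-q_ts$; $\bar q_t=\lfloor\frac{tn-i}{s}\rfloor$ and $\bar r_t=tn-i-\bar q_ts$. Set $\ell^1(i)=r+q$, $\ell^2(i)=1+s-r+q$, $\ell^{1,t}(i)=r_t+q_t$, $\ell^{2,t}(i)=1+s-r_t+q_t$, $\ell^{3,t}(i)=\bar r_t+\bar q_t$, $\ell^{4,t}(i)=1+s-\bar r_t+\bar q_t$. *)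

(* Defs.v *)
From mathcomp Require Import all_boot all_order all_algebra.

Set Implicit Arguments.
Unset Strict Implicit.
Unset Printing Implicit Defensive.

Local Open Scope nat_scope.

(* [x :: p] is a path (no repeated vertex) from [x] to [y]; its number of
   edges is [size p]. *)
Definition is_gpath (T : finType) (e : rel T) (x y : T) (p : seq T) : Prop :=
  [/\ path e x p, last x p = y & uniq (x :: p)].

(* The distance as a relation: it holds for no [d] when [x] and [y] are not
   connected, and for at most one [d] in general (see [is_dist_inj]). *)
Definition is_dist (T : finType) (e : rel T) (x y : T) (d : nat) : Prop :=
  (exists2 p, is_gpath e x y p & size p = d) /\
  (forall p, is_gpath e x y p -> d <= size p).

Lemma is_dist_inj (T : finType) (e : rel T) (x y : T) (d1 d2 : nat) :
  is_dist e x y d1 -> is_dist e x y d2 -> d1 = d2.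
Proof.
move=> [[p1 P1 <-] m1] [[p2 P2 <-] m2].
by apply/eqP; rewrite eqn_leq m1 // m2.
Qed.

(* The subtraction [n - `|x|] is exact when [x] is a difference of two
   elements of {0, ..., n - 1}. *)
Definition circ_norm (n : nat) (x : int) : nat := minn `|x| (n - `|x|).

Definition circulant (n s : nat) : rel 'I_n :=
  fun i j => (i != j) && (circ_norm n (Posz i - Posz j)%R \in [:: 1; s]).

Definition vertex0 (n : nat) (hn : 5 <= n) : 'I_n :=
  Ordinal (leq_trans (isT : 0 < 5) hn).

(* Below, the truncated subtractions are exact: remainders are < s, and
   t * n - i is only used for i < n and 1 <= t. *)
Definition ell1 (s i : nat) : nat := i %% s + i %/ s.
Definition ell2 (s i : nat) : nat := 1 + s - i %% s + i %/ s.
Definition ell1t (n s t i : nat) : nat :=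
  (t * n + i) %% s + (t * n + i) %/ s.
Definition ell2t (n s t i : nat) : nat :=
  1 + s - (t * n + i) %% s + (t * n + i) %/ s.
Definition ell3t (n s t i : nat) : nat :=
  (t * n - i) %% s + (t * n - i) %/ s.
Definition ell4t (n s t i : nat) : nat :=
  1 + s - (t * n - i) %% s + (t * n - i) %/ s.

(* The starting value of the iterated minimum is itself one of the values to
   be minimised, since [minn] has no neutral element. *)
Definition min_ell (n s i : nat) : nat :=
  \big[minn/minn (ell1 s i) (ell2 s i)]_(1 <= t < (s %/ gcdn n s).+1)
    minn (minn (ell1t n s t i) (ell2t n s t i))
         (minn (ell3t n s t i) (ell4t n s t i)).

(* Main.v *)
Require Import Defs.
From mathcomp Require Import all_boot all_order all_algebra.
From mathcomp Require Import zify.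

(** The circulant graph C_n(1,s) is a Cayley graph of Z/n, so a walk from x to
    y amounts to a choice of a steps +-1 and b steps +-s with
    y - x = a + b s modulo n, and only |a| + |b| is relevant to its length
    ([walk_of_combination], [combination_of_walk]).  The distance from 0 to i
    is hence the minimum of |a| + |b| over the integer solutions of
    a + b s = i + k n, with k in Z.

    For a fixed value m >= 0 of a + b s, the quantity |m - b s| + |b| decreases
    in b up to m / s and increases afterwards: its minimum is reached at
    b = floor(m / s) or at the next integer, which gives the two quantities
    whose minimum is [word_cost s m] below.  The case k = t >= 0 gives
    m = t n + i; for k = - t < 0 the change of (a, b) to (- a, - b) gives
    m = t n - i.

    Finally t can be bounded by T = s / gcd(n, s): as T n is the multiple
    n / gcd(n, s) of s, replacing t by t - T keeps the remainder modulo s and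
    decreases the quotient, so that the cost does not increase
    ([word_cost_addM]). *)

Import Order.TTheory GRing.Theory Num.Theory.

Local Open Scope int_scope.
Local Open Scope nat_scope.

(** * Cost of an integer with respect to the steps 1 and s *)

(** The word length of the natural number [m] in the group Z generated by 1
    and [s]. *)
Definition word_cost (s m : nat) : nat :=
  minn (m %% s + m %/ s) (1 + s - m %% s + m %/ s).

(** Moving [b] by one towards [m / s] saves [s] in [`|a|] and adds at most 1
    to [`|b|], so that [b] may be moved as far as [m / s] rounded down or up,
    according to the side it comes from. *)
Lemma word_cost_le (s m : nat) (a b : int) :
  0 < s -> (a + b * s%:Z = m%:Z)%R -> word_cost s m <= `|a| + `|b|.
Proof.
move=> s0 eq_m; rewrite /word_cost.
have := divn_eq m s; have := ltn_pmod m s0.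
move: (m %/ s) (m %% s) => q r r_lt m_eq; rewrite geq_min.
have [b_le|b_gt] : (b <= q%:Z \/ b >= q%:Z + 1)%R by lia.
  have : (0 <= (q%:Z - b) * (s%:Z - 1))%R by nia.
  by move=> ?; apply/orP; left; nia.
have : (0 <= (b - q%:Z - 1) * (s%:Z + 1))%R by nia.
by move=> ?; apply/orP; right; nia.
Qed.

Lemma word_cost_attained (s m : nat) :
  0 < s ->
  exists a b : int, (a + b * s%:Z = m%:Z)%R /\ `|a| + `|b| = word_cost s m.
Proof.
move=> s0; rewrite /word_cost; have := divn_eq m s; have := ltn_pmod m s0.
move: (m %/ s) (m %% s) => q r r_lt m_eq.
have [_|_] := leqP (r + q) (1 + s - r + q).
  by exists r%:Z, q%:Z; split; lia.
by exists (r%:Z - s%:Z)%R, (q%:Z + 1)%R; split; lia.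
Qed.

Lemma word_cost_addM (s m c : nat) :
  0 < s -> word_cost s m <= word_cost s (c * s + m).
Proof. by move=> s0; rewrite /word_cost modnMDl divnMDl //; lia. Qed.

(** * The minimum over a period *)

Lemma min_ellE (n s i : nat) :
  min_ell n s i =
  \big[minn/word_cost s i]_(1 <= t < (s %/ gcdn n s).+1)
    minn (word_cost s (t * n + i)) (word_cost s (t * n - i)).
Proof. by []. Qed.

Lemma min_ell_le_idx (n s i : nat) : min_ell n s i <= word_cost s i.
Proof. by rewrite min_ellE -minEnat -leEnat bigmin_le_id. Qed.

Lemma min_ell_le (n s i t : nat) :
  0 < t <= s %/ gcdn n s ->
  min_ell n s i <= minn (word_cost s (t * n + i)) (word_cost s (t * n - i)).
Proof.
move=> t_in; rewrite min_ellE -minEnat -leEnat.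
by apply: (ge_bigmin_seq _ t); rewrite ?mem_index_iota.
Qed.

Lemma period_mul (n s : nat) : s %/ gcdn n s * n = n %/ gcdn n s * s.
Proof.
by rewrite divn_mulAC ?dvdn_gcdr // mulnC -divn_mulAC ?dvdn_gcdl.
Qed.

Lemma period_gt0 (n s : nat) : 0 < s -> 0 < s %/ gcdn n s.
Proof.
move=> s0; rewrite divn_gt0 ?gcdn_gt0 ?s0 ?orbT //.
by rewrite dvdn_leq ?dvdn_gcdr.
Qed.

(** The induction replaces [t > T = s / gcd(n, s)] by [t - T], which stays
    positive: this matters in [min_ell_le_sub], where [t = 0] is excluded. *)
Lemma min_ell_le_add (n s i t : nat) :
  0 < s -> min_ell n s i <= word_cost s (t * n + i).
Proof.
move=> s0; pose T := s %/ gcdn n s.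
elim/ltn_ind: t => t IHt.
have [->|t0] := posnP t; first exact: min_ell_le_idx.
have [t_le|t_gt] := leqP t T.
  have t_in : 0 < t <= T by rewrite t0.
  by apply: leq_trans (min_ell_le _ _ _ _ t_in) (geq_minl _ _).
have T0 : 0 < T by apply: period_gt0.
have t_lt : t - T < t by lia.
apply: leq_trans (IHt _ t_lt) _.
have -> : t * n + i = n %/ gcdn n s * s + ((t - T) * n + i).
  by rewrite -period_mul -/T addnA -mulnDl subnKC // ltnW.
exact: word_cost_addM.
Qed.

Lemma min_ell_le_sub (n s i t : nat) :
  0 < s -> 0 < t -> i < n -> min_ell n s i <= word_cost s (t * n - i).
Proof.
move=> s0 t0 i_lt; pose T := s %/ gcdn n s.
elim/ltn_ind: t t0 => t IHt t0.
have [t_le|t_gt] := leqP t T.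
  have t_in : 0 < t <= T by rewrite t0.
  by apply: leq_trans (min_ell_le _ _ _ _ t_in) (geq_minr _ _).
have T0 : 0 < T by apply: period_gt0.
have t_lt : t - T < t by lia.
have tT0 : 0 < t - T by lia.
apply: leq_trans (IHt _ t_lt tT0) _.
have -> : t * n - i = n %/ gcdn n s * s + ((t - T) * n - i).
  rewrite -period_mul -/T addnBA -?mulnDl ?subnKC // 1?ltnW //.
  by apply: leq_trans i_lt _; rewrite leq_pmull.
exact: word_cost_addM.
Qed.

Lemma min_ell_le_combination (n s i : nat) (a b k : int) :
  0 < s -> i < n -> (a + b * s%:Z = i%:Z + k * n%:Z)%R ->
  min_ell n s i <= `|a| + `|b|.
Proof.
move=> s0 i_lt; case: k => t eq_i.
  apply: leq_trans (min_ell_le_add n s i t s0) _.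
  by apply: word_cost_le => //; rewrite eq_i; lia.
apply: leq_trans (min_ell_le_sub n s i t.+1 s0 (ltn0Sn t) i_lt) _.
have -> : `|a| + `|b| = `|(- a)%R| + `|(- b)%R| by lia.
apply: word_cost_le => //.
have : i <= t.+1 * n by apply: leq_trans (ltnW i_lt) _; rewrite leq_pmull.
by move: eq_i; rewrite NegzE; nia.
Qed.

Lemma min_ell_combination (n s i : nat) :
  0 < s -> i < n ->
  exists a b k : int,
    (a + b * s%:Z = i%:Z + k * n%:Z)%R /\ `|a| + `|b| = min_ell n s i.
Proof.
move=> s0 i_lt; rewrite min_ellE big_nat.
pose attained v := exists a b k : int,
  (a + b * s%:Z = i%:Z + k * n%:Z)%R /\ `|a| + `|b| = v.
have attained_min u v : attained u -> attained v -> attained (minn u v).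
  by case: (leqP u v).
have attained_add t : attained (word_cost s (t * n + i)).
  have [a [b [eq_m <-]]] := @word_cost_attained s (t * n + i) s0.
  by exists a, b, t%:Z; split=> //; rewrite eq_m; lia.
apply: (big_ind attained) => //; first exact: (attained_add 0).
move=> t /andP[t0 _]; apply: attained_min => //.
have [a [b [eq_m <-]]] := @word_cost_attained s (t * n - i) s0.
exists (- a)%R, (- b)%R, (- t%:Z)%R; split; last by lia.
have : i <= t * n by apply: leq_trans (ltnW i_lt) _; rewrite leq_pmull.
by nia.
Qed.

(** * Walks in the circulant graph *)

(** As [s < n / 2], none of the steps 1, - 1, s, - s vanishes modulo [n], and
    both of s and - s have circular norm [s]: adjacency is a congruence, in
    which absolute values and truncated subtractions no longer occur. *)
Lemma circulantP (n s : nat) (x y : 'I_n) :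
  0 < s -> s.*2 < n ->
  reflect (exists z k : int,
             (z \in [:: 1; - 1; s%:Z; - s%:Z]%R) /\
             (y%:Z = x%:Z + z + k * n%:Z)%R)
          (circulant s x y).
Proof.
move=> s0 s_lt; have x_lt := ltn_ord x; have y_lt := ltn_ord y.
rewrite /circulant -val_eqE /= /circ_norm !inE.
apply: (iffP idP) => [e_xy | [z [k [z_in eq_y]]]].
  have : (y%:Z - x%:Z = 1 \/ y%:Z - x%:Z = -1 \/ y%:Z - x%:Z = s%:Z \/
    y%:Z - x%:Z = - s%:Z \/ y%:Z - x%:Z = n%:Z - 1 \/ y%:Z - x%:Z = 1 - n%:Z
    \/ y%:Z - x%:Z = n%:Z - s%:Z \/ y%:Z - x%:Z = s%:Z - n%:Z)%R by lia.
  case=> [?|[?|[?|[?|[?|[?|[?|?]]]]]]].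
  - by exists 1%R, 0%R; rewrite !inE ?eqxx ?orbT; split=> //; lia.
  - by exists (- 1)%R, 0%R; rewrite !inE ?eqxx ?orbT; split=> //; lia.
  - by exists s%:Z, 0%R; rewrite !inE ?eqxx ?orbT; split=> //; lia.
  - by exists (- s%:Z)%R, 0%R; rewrite !inE ?eqxx ?orbT; split=> //; lia.
  - by exists (- 1)%R, 1%R; rewrite !inE ?eqxx ?orbT; split=> //; lia.
  - by exists 1%R, (-1)%R; rewrite !inE ?eqxx ?orbT; split=> //; lia.
  - by exists (- s%:Z)%R, 1%R; rewrite !inE ?eqxx ?orbT; split=> //; lia.
  - by exists s%:Z, (-1)%R; rewrite !inE ?eqxx ?orbT; split=> //; lia.
move: z_in; rewrite !inE => z_in.
have z_bound : (`|z| <= s%:Z)%R /\ (0 < `|z|)%R by lia.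
(* Both x and y lie in [0, n) and the step is shorter than n / 2. *)
have : (k = 0 \/ k = 1 \/ k = -1)%R.
  have : (k <= -2 \/ 2 <= k \/ (k = 0 \/ k = 1 \/ k = -1))%R by lia.
  by case=> [?|[?|//]]; nia.
by case=> [?|[?|?]]; subst k; lia.
Qed.

Lemma walk_repeat (n s : nat) (z : int) (j : nat) (x : 'I_n) :
  0 < s -> s.*2 < n -> (z \in [:: 1; - 1; s%:Z; - s%:Z]%R) ->
  exists (p : seq 'I_n) (k : int),
    [/\ path (circulant s) x p, size p = j &
        ((last x p)%:Z = x%:Z + j%:Z * z + k * n%:Z)%R].
Proof.
move=> s0 s_lt z_in; have n0 : 0 < n by lia.
elim: j x => [|j IHj] x; first by exists [::], 0%R; split=> //=; lia.
have n_neq0 : (n%:Z != 0)%R by lia.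
have y_ge0 := modz_ge0 (x%:Z + z)%R n_neq0.
have y_ltn := ltz_pmod (x%:Z + z)%R (n0 : (0 < n%:Z)%R).
have y_eq := divz_eq (x%:Z + z)%R n%:Z.
have y_lt : `|((x%:Z + z)%R %% n%:Z)%Z| < n by lia.
pose y := Ordinal y_lt.
have yE : (y%:Z = x%:Z + z + - ((x%:Z + z)%R %/ n%:Z)%Z * n%:Z)%R.
  by rewrite /=; lia.
have [p [k [e_p <- last_p]]] := IHj y.
exists (y :: p), (k - ((x%:Z + z)%R %/ n%:Z)%Z)%R; split=> //=.
  rewrite e_p andbT; apply/(circulantP _ _ _ _ s0 s_lt).
  by exists z; eexists; split; last exact: yE.
by rewrite last_p yE; lia.
Qed.

(** As the steps commute, all steps +-1 may be made before all steps +-s. *)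
Lemma walk_of_combination (n s : nat) (x y : 'I_n) (a b k : int) :
  0 < s -> s.*2 < n -> (x%:Z + a + b * s%:Z = y%:Z + k * n%:Z)%R ->
  exists2 p : seq 'I_n,
    path (circulant s) x p /\ last x p = y & size p = `|a| + `|b|.
Proof.
move=> s0 s_lt eq_y.
have [z z_in aE] : exists2 z : int,
    (z \in [:: 1; - 1; s%:Z; - s%:Z]%R) & (a = `|a|%N%:Z * z)%R.
  by case: (lerP 0 a)%R => ?; [exists 1%R|exists (- 1)%R];
    rewrite ?inE ?eqxx ?orbT //; lia.
have [w w_in bE] : exists2 w : int,
    (w \in [:: 1; - 1; s%:Z; - s%:Z]%R) & (b * s%:Z = `|b|%N%:Z * w)%R.
  by case: (lerP 0 b)%R => ?; [exists s%:Z|exists (- s%:Z)%R];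
    rewrite ?inE ?eqxx ?orbT //; lia.
have [p [k1 [e_p size_p last_p]]] := walk_repeat n s z `|a| x s0 s_lt z_in.
have [p' [k2 [e_p' size_p' last_p']]] :=
  walk_repeat n s w `|b| (last x p) s0 s_lt w_in.
exists (p ++ p'); last by rewrite size_cat size_p size_p'.
rewrite cat_path e_p e_p' last_cat; split=> //; apply/val_inj => /=.
have x'_lt := ltn_ord (last (last x p) p'); have y_lt := ltn_ord y.
have : ((last (last x p) p')%:Z - y%:Z = (k + k1 + k2) * n%:Z)%R by lia.
move: (k + k1 + k2)%R => c eq_c.
have : (c <= -1 \/ 1 <= c \/ c = 0)%R by lia.
by case=> [?|[?|?]]; nia.
Qed.

Lemma combination_of_walk (n s : nat) (x : 'I_n) (p : seq 'I_n) :
  0 < s -> s.*2 < n -> path (circulant s) x p ->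
  exists a b k : int,
    (x%:Z + a + b * s%:Z = (last x p)%:Z + k * n%:Z)%R /\
    `|a| + `|b| <= size p.
Proof.
move=> s0 s_lt; elim: p x => [|y p IHp] x /=.
  by exists 0%R, 0%R, 0%R; split=> //; lia.
case/andP=> /(circulantP _ _ _ _ s0 s_lt)[z [k0 [z_in eq_y]]].
case/IHp=> a [b [k [eq_p le_p]]].
move: z_in; rewrite !inE => /or4P[] /eqP zE.
- by exists (a + 1)%R, b, (k - k0)%R; split; lia.
- by exists (a - 1)%R, b, (k - k0)%R; split; lia.
- by exists a, (b + 1)%R, (k - k0)%R; split; lia.
- by exists a, (b - 1)%R, (k - k0)%R; split; lia.
Qed.

(** Paths may be replaced by walks in the definition of the distance, because
    removing the loops of a walk does not make it longer. *)
Lemma is_dist_walk (T : finType) (e : rel T) (x y : T) (d : nat) :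
  (exists2 p, path e x p /\ last x p = y & size p = d) ->
  (forall p, path e x p -> last x p = y -> d <= size p) ->
  is_dist e x y d.
Proof.
move=> [p [e_p last_p] size_p] d_min; split; last first.
  by move=> p' [e_p' last_p' _]; apply: d_min.
case: (shortenP e_p) last_p => p' e_p' uniq_p' sub_p' last_p'.
exists p' => //; apply/eqP; rewrite eqn_leq d_min // andbT -size_p.
by apply: uniq_leq_size sub_p'; case/andP: uniq_p'.
Qed.

Theorem lemma2p20 (n s : nat) (hn : 5 <= n) (hs2 : 2 <= s)
    (hs : s <= (n - 1) %/ 2) (i : 'I_n) :
  is_dist (@circulant n s) (vertex0 hn) i (min_ell n s i).
Proof.
have s0 : 0 < s by apply: ltnW.
have s_lt : s.*2 < n by lia.
apply: is_dist_walk => [|p e_p last_p].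
  have [a [b [k [eq_i <-]]]] := min_ell_combination n s i s0 (ltn_ord i).
  by apply: (walk_of_combination _ _ _ _ _ _ k) => //=; rewrite GRing.add0r.
have [a [b [k [eq_i le_p]]]] := combination_of_walk _ _ _ _ s0 s_lt e_p.
apply: leq_trans le_p; apply: (min_ell_le_combination _ _ _ _ _ k) => //.
by rewrite -last_p -eq_i GRing.add0r.
Qed.
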